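(* Let $\mathbf{Z}$ be a $3$-dimensional complex non-split Zinbiel superalgebra. Then $\mathbf{Z}$ is isomorphic to a $3$-dimensional Zinbiel algebra or to only one of the following superalgebras, where vectors $e_i$ are even, vectors $f_i$ are odd, products of basis vectors not listed are zero, and $\alpha\in\mathbb{C}$ is a parameter. With basis $e_1\,|\,f_1,f_2$ (even part of dimension $1$, odd part of dimension $2$): - $\mathbf{z}_{3,1}^{\alpha}$: $f_1f_1=e_1,\ f_2f_1=e_1,\ f_2f_2=\alpha e_1$; - $\mathbf{z}_{3,2}$: $f_1f_1=e_1,\ f_2f_2=e_1$; - $\mathbf{z}_{3,3}$: $f_1f_1=e_1$; - $\mathbf{z}_{3,4}$: $f_1f_2=e_1,\ f_2f_1=-e_1$; - $\mathbf{z}_{3,5}$: $f_1e_1=f_2,\ f_1f_1=e_1$; - $\mathbf{z}_{3,6}$: $f_1e_1=f_2$; - $\mathbf{z}_{3,7}$: $e_1f_1=\alpha f_2,\ f_1e_1=f_2$; - $\mathbf{z}_{3,8}$: $e_1f_1=f_2$. With basis $e_1,e_2\,|\,f_1$ (even part of dimension $2$, odd part of dimension $1$): - $\mathbf{z}_{3,9}$: $e_1e_1=e_2,\ f_1f_1=e_2$.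
   Context: A Zinbiel superalgebra is a $\mathbb{Z}_2$-graded vector space $\mathbf{Z}=\mathbf{Z}_{\bar 0}\oplus\mathbf{Z}_{\bar 1}$ with a bilinear product satisfying $\mathbf{Z}_i\mathbf{Z}_j\subset\mathbf{Z}_{i+j}$ and $(xy)z=x\big(yz+(-1)^{|y||z|}zy\big)$ for all homogeneous $x,y,z$. A Zinbiel algebra is an algebra satisfying $(xy)z=x(yz+zy)$; it is regarded as a superalgebra with zero odd part. A superalgebra is split if it is a direct sum of two nonzero graded ideals, and non-split otherwise. Isomorphisms of superalgebras preserve the $\mathbb{Z}_2$-grading. *)

(* Defs.v *)
From HB Require Import structures.
From mathcomp Require Import all_boot all_algebra.
From mathcomp Require Export reals complex.

Set Implicit Arguments.
Unset Strict Implicit.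
Unset Printing Implicit Defensive.

Import GRing.Theory.
Local Open Scope ring_scope.

(* MathComp's algebra structures are all associative, hence the following. *)
Record algebra (K : fieldType) := Algebra {
  alg_carrier :> vectType K;
  mul : {bilinear alg_carrier -> alg_carrier -> alg_carrier}
}.

Arguments mul {K a}.

Definition zinbiel (K : fieldType) (A : algebra K) : Prop :=
  forall x y z : A, mul (mul x y) z = mul x (mul y z + mul z y).

(* Z/2Z is represented by bool: false is the even degree, true the odd
   degree, and addition is the exclusive or (+). *)
Record superalgebra (K : fieldType) := Superalgebra {
  super_alg :> algebra K;
  part : bool -> {vspace super_alg};
  part_sum : (part false + part true)%VS = fullv;
  part_cap : (part false :&: part true)%VS = 0%VS;
  part_mul : forall i j x y,
    x \in part i -> y \in part j -> mul x y \in part (i (+) j)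
}.

Definition zinbiel_super (K : fieldType) (A : superalgebra K) : Prop :=
  forall (i j k : bool) (x y z : A),
    x \in part A i -> y \in part A j -> z \in part A k ->
    mul (mul x y) z = mul x (mul y z + (-1) ^+ (j && k) *: mul z y).

Section EvenSuperalgebra.
Variables (K : fieldType) (A : algebra K).

Definition even_part (i : bool) : {vspace A} := if i then 0%VS else fullv.

Fact even_part_sum : (even_part false + even_part true)%VS = fullv.
Proof. exact: addv0. Qed.

Fact even_part_cap : (even_part false :&: even_part true)%VS = 0%VS.
Proof. exact: capv0. Qed.

Fact even_part_mul i j x y : x \in even_part i -> y \in even_part j ->
  mul x y \in even_part (i (+) j).
Proof.
case: i j => [] [] //= + +; rewrite ?memvf ?memv0 //.
- by move=> /eqP-> _; rewrite linear0l.
- by move=> _ /eqP->; rewrite linear0r.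
Qed.

Definition even_superalgebra : superalgebra K :=
  Superalgebra even_part_sum even_part_cap even_part_mul.
End EvenSuperalgebra.

Definition graded_ideal (K : fieldType) (A : superalgebra K)
    (I : {vspace A}) : Prop :=
  I = ((I :&: part A false) + (I :&: part A true))%VS
  /\ forall x y : A, x \in I -> mul x y \in I /\ mul y x \in I.

Definition split_super (K : fieldType) (A : superalgebra K) : Prop :=
  exists I J : {vspace A},
    [/\ graded_ideal I, graded_ideal J, I != 0%VS & J != 0%VS]
    /\ (I + J)%VS = fullv /\ (I :&: J)%VS = 0%VS.

Definition super_iso (K : fieldType) (A B : superalgebra K) : Prop :=
  exists f : 'Hom(A, B),
    [/\ bijective f,
        forall x y : A, f (mul x y) = mul (f x) (f y)
      & forall i : bool, (f @: part A i)%VS = part B i].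

(* [Entry i j a k] records the product b_i b_j = a b_k of basis vectors. *)
Record entry (K : fieldType) (n : nat) :=
  Entry { e_left : 'I_n; e_right : 'I_n; e_coef : K; e_res : 'I_n }.

(* The superalgebra on K^n whose basis vector b_i = delta_mx 0 i is odd iff
   [is_odd i]; the products of basis vectors that have no entry in T are 0. *)
Section TableSuperalgebra.
Variables (K : fieldType) (n : nat) (is_odd : pred 'I_n) (T : seq (entry K n)).
Hypothesis T_graded :
  all (fun t => is_odd (e_res t) == is_odd (e_left t) (+) is_odd (e_right t)) T.

Definition table_mul (x y : 'rV[K]_n) : 'rV[K]_n :=
  \sum_(t <- T) (x 0 (e_left t) * y 0 (e_right t) * e_coef t)
                  *: delta_mx 0 (e_res t).

Fact table_bilinear : bilinear_for *:%R *:%R table_mul.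
Proof.
split=> [y|x] a u v; rewrite /table_mul /= scaler_sumr -big_split /=;
  apply: eq_bigr => t _; rewrite !mxE scalerA -scalerDl; congr (_ *: _).
- by rewrite !mulrDl !mulrA.
- by rewrite mulrDr mulrDl !mulrA (mulrC (x _ _) a).
Qed.

HB.instance Definition _ :=
  bilinear_isBilinear.Build K 'rV[K]_n 'rV[K]_n 'rV[K]_n *:%R *:%R
    table_mul table_bilinear.

Definition table_algebra : algebra K :=
  @Algebra K 'rV[K]_n (table_mul : {bilinear _ -> _ -> _}).

Definition table_part (i : bool) : {vspace table_algebra} :=
  (\sum_(k | is_odd k == i) <[(delta_mx 0%R k : 'rV[K]_n)]>)%VS.

Lemma table_partP (i : bool) (x : 'rV[K]_n) :
  reflect (forall k, is_odd k != i -> x 0 k = 0) (x \in table_part i).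
Proof.
apply: (iffP idP) => [/memv_sumP[v vP ->] k ki | x0].
  rewrite summxE big1 // => l li; have /vlineP[c ->] := vP l li.
  rewrite !mxE eqxx /=; have [kl|_] := eqVneq k l; last by rewrite mulr0.
  by rewrite kl li in ki.
rewrite (row_sum_delta x); apply: memv_suml => k _.
have [ki|/x0->] := eqVneq (is_odd k) i; last by rewrite scale0r mem0v.
apply: memvZ; apply: (subvP (sumv_sup k _ (subvv _))) (memv_line _).
by rewrite ki.
Qed.

Fact table_part_sum : (table_part false + table_part true)%VS = fullv.
Proof.
apply/vspaceP => x; rewrite memvf; apply/memv_addP.
exists (\row_k if is_odd k then 0 else x 0 k).
  by apply/table_partP => k; rewrite mxE; case: (is_odd k).
exists (\row_k if is_odd k then x 0 k else 0).
  by apply/table_partP => k; rewrite mxE; case: (is_odd k).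
by apply/rowP => k; rewrite !mxE; case: (is_odd k); rewrite ?add0r ?addr0.
Qed.

Fact table_part_cap : (table_part false :&: table_part true)%VS = 0%VS.
Proof.
apply/vspaceP => x; rewrite memv_cap memv0; apply/andP/eqP => [[]|->].
  move=> /table_partP x0 /table_partP x1; apply/rowP => k; rewrite mxE.
  case: (boolP (is_odd k)) => [ok|/negPf ok]; first by apply: x0; rewrite ok.
  by apply: x1; rewrite ok.
by rewrite !mem0v.
Qed.

Fact table_part_mul i j (x y : table_algebra) :
  x \in table_part i -> y \in table_part j ->
  mul x y \in table_part (i (+) j).
Proof.
move=> /table_partP xi /table_partP yj; apply/table_partP => k kij.
rewrite summxE; elim: T T_graded => [_|t s IH /= /andP[/eqP tg sg]].
  by rewrite big_nil.
rewrite big_cons IH // addr0 !mxE eqxx /=.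
have [kt|_] := eqVneq k (e_res t); last by rewrite mulr0.
have [li|/xi->] := eqVneq (is_odd (e_left t)) i; last by rewrite !mul0r.
have [rj|/yj->] := eqVneq (is_odd (e_right t)) j; last by rewrite mulr0 !mul0r.
by move: kij; rewrite kt tg li rj eqxx.
Qed.

Definition table_superalgebra : superalgebra K :=
  @Superalgebra K table_algebra table_part
    table_part_sum table_part_cap table_part_mul.
End TableSuperalgebra.

Section List.
Variable K : fieldType.

Section EvenDim1.
Local Notation e1 := (@Ordinal 3 0 isT).
Local Notation f1 := (@Ordinal 3 1 isT).
Local Notation f2 := (@Ordinal 3 2 isT).
Local Notation super T :=
  (@table_superalgebra K 3 (fun i : 'I_3 => 0 < i)%N T isT).

Definition z3_1 (a : K) : superalgebra K :=
  super [:: Entry f1 f1 1 e1; Entry f2 f1 1 e1; Entry f2 f2 a e1].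
Definition z3_2 : superalgebra K :=
  super [:: Entry f1 f1 1 e1; Entry f2 f2 1 e1].
Definition z3_3 : superalgebra K := super [:: Entry f1 f1 1 e1].
Definition z3_4 : superalgebra K :=
  super [:: Entry f1 f2 1 e1; Entry f2 f1 (-1) e1].
Definition z3_5 : superalgebra K :=
  super [:: Entry f1 e1 1 f2; Entry f1 f1 1 e1].
Definition z3_6 : superalgebra K := super [:: Entry f1 e1 1 f2].
Definition z3_7 (a : K) : superalgebra K :=
  super [:: Entry e1 f1 a f2; Entry f1 e1 1 f2].
Definition z3_8 : superalgebra K := super [:: Entry e1 f1 1 f2].
End EvenDim1.

Section EvenDim2.
Local Notation e1 := (@Ordinal 3 0 isT).
Local Notation e2 := (@Ordinal 3 1 isT).
Local Notation f1 := (@Ordinal 3 2 isT).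

Definition z3_9 : superalgebra K :=
  @table_superalgebra K 3 (fun i : 'I_3 => 1 < i)%N
    [:: Entry e1 e1 1 e2; Entry f1 f1 1 e2] isT.
End EvenDim2.

(* z3_6 and z3_7 0 have the same products and are equal, so uniqueness in the
   list has to be read as uniqueness of the superalgebra, not of its name. *)
Inductive listed : superalgebra K -> Prop :=
| Listed1 (a : K) : listed (z3_1 a)
| Listed2 : listed z3_2
| Listed3 : listed z3_3
| Listed4 : listed z3_4
| Listed5 : listed z3_5
| Listed6 : listed z3_6
| Listed7 (a : K) : listed (z3_7 a)
| Listed8 : listed z3_8
| Listed9 : listed z3_9.
End List.

(* Main.v *)
From HB Require Import structures.
Require Import Defs.
From mathcomp Require Import all_boot all_algebra.
From mathcomp Require Import ring boolp.

(** On a 1|2-dimensional Zinbiel superalgebra, the left and right actions L, R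
    of the even line on the odd plane satisfy L^2 = R^2 = LR = RL = 0, so both
    are multiples of one nilpotent map. If one of them is nonzero, the identity
    leaves only z_{3,5}, ..., z_{3,8}; if both vanish, the product is an
    arbitrary bilinear form on the odd plane, classified up to congruence and
    scaling by orthogonalising against a non-isotropic vector. On a
    2|1-dimensional one, the even part is null or spanned by x and xx, it acts
    trivially on the odd line, and the square of the odd vector is an even
    annihilator; in dimension 0|3 all products vanish.
    Conversely, commutation laws c xy = d yx between homogeneous parts separate
    the entries of the list, except that the form B of z_{3,1}^a also needs the
    invariant ratio a = det B / (B(x,y) - B(y,x))^2, where x, y is any basis of
    the odd plane, and z_{3,2}, z_{3,3} differ by the vanishing of det B. *)

Set Implicit Arguments.
Unset Strict Implicit.
Unset Printing Implicit Defensive.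

Import GRing.Theory Num.Theory.
Local Open Scope ring_scope.

(* [mul] alone is captured by a definition of the same name in MathComp. *)
Local Notation "x ** y" := (Defs.mul x y)
  (at level 40, left associativity) : ring_scope.

Local Notation o0 := (@Ordinal 3 0 isT).
Local Notation o1 := (@Ordinal 3 1 isT).
Local Notation o2 := (@Ordinal 3 2 isT).

(** * Coordinates in dimension three and equality of superalgebras *)

Lemma ord3_ind (P : 'I_3 -> Prop) : P o0 -> P o1 -> P o2 -> forall i, P i.
Proof.
move=> P0 P1 P2 [[|[|[|m]]] lt_m] //.
- by rewrite (_ : Ordinal lt_m = o0) //; apply: val_inj.
- by rewrite (_ : Ordinal lt_m = o1) //; apply: val_inj.
- by rewrite (_ : Ordinal lt_m = o2) //; apply: val_inj.
Qed.

Lemma row3P (R : Type) (x y : 'rV[R]_3) :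
  x ord0 o0 = y ord0 o0 -> x ord0 o1 = y ord0 o1 -> x ord0 o2 = y ord0 o2 ->
  x = y.
Proof. by move=> h0 h1 h2; apply/rowP; apply: ord3_ind. Qed.

Lemma sum3E (V : nmodType) (F : 'I_3 -> V) :
  \sum_i F i = F o0 + F o1 + F o2.
Proof.
rewrite !big_ord_recl big_ord0 addr0 addrA; congr (F _ + F _ + F _);
  exact: val_inj.
Qed.

Lemma bilinear_eq (K : fieldType) (V : vectType K)
    (m m' : {bilinear V -> V -> V}) : m =2 m' -> m = m'.
Proof.
case: m m' => [f [Cf]] [f' [Cf']] /= eqf.
have {eqf}ff' : f = f' by apply/funext => x; apply/funext => y.
rewrite -{f'}ff' in Cf' *.
congr (Bilinear.Pack (Bilinear.Class _)).
case: Cf Cf' => ? ? ? ? [*].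
by congr isBilinear.Axioms_; apply: Prop_irrelevance.
Qed.

(** Uniqueness in the theorem is equality of records, so [z3_6 K] and [z3_7 0] have to be literally
    equal; the fields other than the product and the parts are propositions. *)
Lemma superalgebra_eq (K : fieldType) (V : vectType K)
    (m m' : {bilinear V -> V -> V}) (p : bool -> {vspace V}) s c h s' c' h' :
  m =2 m' ->
  @Superalgebra K (Algebra m) p s c h = @Superalgebra K (Algebra m') p s' c' h'.
Proof.
move=> /bilinear_eq mm'; rewrite -{m'}mm' in s' c' h' *.
by congr Superalgebra; apply: Prop_irrelevance.
Qed.

Lemma z3_6_7 (K : fieldType) : z3_6 K = z3_7 0.
Proof.
apply: superalgebra_eq => x y /=.
by rewrite /table_mul !big_cons !big_nil /= mulr0 scale0r add0r.
Qed.

(** * Isomorphism invariants *)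

Section Invariants.
Variable K : fieldType.
Implicit Types A B : superalgebra K.

(** Two scalars let one law express vanishing in either order, commutativity, anticommutativity and
    the parameter of [z3_7]. *)
Definition skew_commute A (i j : bool) (c d : K) : Prop :=
  forall x y : A, x \in part A i -> y \in part A j ->
  c *: (x ** y) = d *: (y ** x).

(** [p * s - q * r] is the Gram determinant of the odd product in units of [e]. A change of basis of
    determinant d multiplies it by d^2 and [q - r] by d, and rescaling [e] affects both sides
    alike. *)
Definition form_ratio A (a : K) : Prop :=
  forall (e x y : A) (p q r s : K), e != 0 ->
  x \in part A true -> y \in part A true ->
  [/\ x ** x = p *: e, x ** y = q *: e, y ** x = r *: e & y ** y = s *: e] ->
  p * s - q * r = a * (q - r) ^+ 2.

Lemma super_iso_sym A B : super_iso A B -> super_iso B A.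
Proof.
move=> [f [fbij fM fpart]].
have finj : lker f == 0%VS by apply/lker0P; apply: bij_inj.
have fK := lker0_lfunK finj.
have fVK : cancel (f^-1)%VF f by case: fbij => g gK Kg x; rewrite -(Kg x) fK.
exists (f^-1)%VF; split.
- by exists f.
- by move=> x y; rewrite -{1}(fVK x) -{1}(fVK y) -fM fK.
- by move=> i; rewrite -fpart -limg_comp lker0_compVf // lim1g.
Qed.

Lemma super_iso_skew_commute A B i j c d :
  super_iso A B -> skew_commute A i j c d -> skew_commute B i j c d.
Proof.
move=> [f [_ fM fpart]] hA x y; rewrite -!fpart.
move=> /memv_imgP[u uA ->] /memv_imgP[v vA ->].
by have := congr1 f (hA u v uA vA); rewrite !linearZ /= !fM.
Qed.

Lemma super_iso_form_ratio A B a :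
  super_iso A B -> form_ratio A a -> form_ratio B a.
Proof.
move=> [f [fbij fM fpart]] hA e x y p q r s + + + [].
have finj := bij_inj fbij; have [g fK gK] := fbij.
rewrite -(gK e) -!fpart => e0 /memv_imgP[u uA ->] /memv_imgP[v vA ->].
rewrite -!fM -!(linearZ_LR f) => /finj hp /finj hq /finj hr /finj hs.
apply: (hA (g e) u v) => //.
by apply: contra_neq e0 => ->; rewrite linear0.
Qed.

(* The index in the list, with 7 for both z_{3,6} = z_{3,7}^0 and z_{3,7}^a. *)
Definition kind A : nat :=
  let sc i j c d := `[< skew_commute A i j c d >] in
  if ~~ sc false false 1 0 then 9%N
  else if sc false true 0 1 then
    if ~~ sc false true 1 0 then 8%N
    else if sc true true 1 (-1) then 4%N
    else if sc true true 1 1 then if `[< form_ratio A 0 >] then 3%N else 2%N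
    else 1%N
  else if sc true true 1 0 then 7%N else 5%N.

Lemma super_iso_kind A B : super_iso A B -> kind A = kind B.
Proof.
move=> AB; have BA := super_iso_sym AB.
have sc i j c d : `[< skew_commute A i j c d >] = `[< skew_commute B i j c d >].
  by apply: asbool_equiv_eq; split; apply: super_iso_skew_commute.
have fr : `[< form_ratio A 0 >] = `[< form_ratio B 0 >].
  by apply: asbool_equiv_eq; split; apply: super_iso_form_ratio.
by rewrite /kind !sc fr.
Qed.

End Invariants.

(** * Invariants of the listed superalgebras *)

Section Tables.
Variables (K : numClosedFieldType).

Lemma delta_table_part (n : nat) (is_odd : pred 'I_n) (T : seq (entry K n))
    k i :
  is_odd k = i -> (delta_mx 0 k : 'rV[K]_n) \in table_part is_odd T i.
Proof.
move=> ki; apply/table_partP => l; rewrite mxE eqxx /=.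
by case: (eqVneq l k) => [->|//]; rewrite ki eqxx.
Qed.

Ltac prove_skew_commute :=
  let hx := fresh in let hy := fresh in
  move=> x y /table_partP hx /table_partP hy;
  rewrite /= /table_mul !big_cons !big_nil /=;
  apply: row3P; rewrite !mxE /=;
  do ?[rewrite (hx o0 isT)|rewrite (hx o1 isT)|rewrite (hx o2 isT)
      |rewrite (hy o0 isT)|rewrite (hy o1 isT)|rewrite (hy o2 isT)];
  rewrite ?(mulr0, mul0r, mulr1, mul1r, addr0, add0r); ring.

(* The law fails in coordinate k of the product of the basis vectors i, j. *)
Tactic Notation "refute_skew_commute" constr(i) constr(j) constr(k) :=
  let h := fresh in
  move=> /(_ (delta_mx 0 i) (delta_mx 0 j)) h;
  have := h (delta_table_part _ erefl) (delta_table_part _ erefl);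
  rewrite /= /table_mul !big_cons !big_nil /= => /rowP/(_ k);
  rewrite !mxE /= ?(mulr0, mul0r, mulr1, mul1r, addr0, add0r, mulrN1);
  apply/eqP; first [by rewrite oner_eq0 | by rewrite eq_sym oner_eq0
    | by rewrite eq_sym eqNr oner_eq0].

(** At a coordinate where [e] is nonzero, the hypothesis is the wanted identity multiplied by the
    square of that coordinate. *)
Lemma table_form_ratio (n : nat) (is_odd : pred 'I_n) (T : seq (entry K n))
    (g : all (fun t => is_odd (e_res t) ==
       is_odd (e_left t) (+) is_odd (e_right t)) T) (a : K) :
  (forall (x y : 'rV[K]_n) k, x \in table_part is_odd T true ->
     y \in table_part is_odd T true ->
     table_mul T x x 0 k * table_mul T y y 0 k
       - table_mul T x y 0 k * table_mul T y x 0 k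
     = a * (table_mul T x y 0 k - table_mul T y x 0 k) ^+ 2) ->
  form_ratio (table_superalgebra g) a.
Proof.
move=> hT e x y p q r s e0 xodd yodd [hp hq hr hs].
have /rV0Pn[k ek] := e0.
have := hT x y k xodd yodd.
move: hp hq hr hs => /= -> -> -> ->; rewrite !mxE => H.
apply: (mulIf (expf_neq0 2 ek)).
transitivity (p * e 0 k * (s * e 0 k) - q * e 0 k * (r * e 0 k)); first ring.
rewrite H; ring.
Qed.

Lemma z3_1_form_ratio (a : K) : form_ratio (z3_1 a) a.
Proof.
apply: table_form_ratio => x y k _ _.
rewrite /table_mul !big_cons !big_nil /= !mxE; ring.
Qed.

Lemma z3_3_form_ratio : form_ratio (z3_3 K) 0.
Proof.
apply: table_form_ratio => x y k _ _.
rewrite /table_mul !big_cons !big_nil /= !mxE; ring.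
Qed.

(** On f_1, f_2 the Gram matrix has rows (1, 0) and (1, a), with determinant [a] and skew difference
    -1. *)
Lemma z3_1_form_ratio_inj (a b : K) : form_ratio (z3_1 a) b -> a = b.
Proof.
have d0 : delta_mx 0 o0 != 0 :> 'rV[K]_3.
  by apply/rV0Pn; exists o0; rewrite mxE oner_eq0.
move=> /(_ (delta_mx 0 o0) (delta_mx 0 o1) (delta_mx 0 o2) 1 0 1 a d0)
  /(_ (delta_table_part _ erefl) (delta_table_part _ erefl)) h.
suff : 1 * a - 0 * 1 = b * (0 - 1) ^+ 2.
  by rewrite sub0r sqrrN expr1n mulr1 mul1r mulr1 subr0.
apply: h; split; rewrite /= /table_mul !big_cons !big_nil /= !mxE /=;
  apply: row3P; rewrite !mxE /=; ring.
Qed.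

(** On f_1, f_2 the Gram matrix is the identity, with determinant 1 and skew difference 0. *)
Lemma z3_2_not_form_ratio : ~ form_ratio (z3_2 K) 0.
Proof.
have d0 : delta_mx 0 o0 != 0 :> 'rV[K]_3.
  by apply/rV0Pn; exists o0; rewrite mxE oner_eq0.
move=> /(_ (delta_mx 0 o0) (delta_mx 0 o1) (delta_mx 0 o2) 1 0 0 1 d0)
  /(_ (delta_table_part _ erefl) (delta_table_part _ erefl)) h.
suff : 1 * 1 - 0 * 0 = 0 * (0 - 0) ^+ 2 :> K.
  by rewrite mul1r !mul0r subr0; apply/eqP; rewrite oner_eq0.
apply: h; split; rewrite /= /table_mul !big_cons !big_nil /= !mxE /=;
  apply: row3P; rewrite !mxE /=; ring.
Qed.

Lemma kind_z3_1 a : kind (z3_1 a : superalgebra K) = 1%N.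
Proof.
rewrite /kind asboolT /=; last by prove_skew_commute.
rewrite asboolT /=; last by prove_skew_commute.
rewrite asboolT /=; last by prove_skew_commute.
rewrite asboolF; last by refute_skew_commute o1 o1 o0.
by rewrite asboolF //; refute_skew_commute o1 o2 o0.
Qed.

Lemma kind_z3_2 : kind (z3_2 K) = 2%N.
Proof.
rewrite /kind asboolT /=; last by prove_skew_commute.
rewrite asboolT /=; last by prove_skew_commute.
rewrite asboolT /=; last by prove_skew_commute.
rewrite asboolF; last by refute_skew_commute o1 o1 o0.
rewrite asboolT; last by prove_skew_commute.
by rewrite asboolF //; apply: z3_2_not_form_ratio.
Qed.

Lemma kind_z3_3 : kind (z3_3 K) = 3%N.
Proof.
rewrite /kind asboolT /=; last by prove_skew_commute.
rewrite asboolT /=; last by prove_skew_commute.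
rewrite asboolT /=; last by prove_skew_commute.
rewrite asboolF; last by refute_skew_commute o1 o1 o0.
rewrite asboolT; last by prove_skew_commute.
by rewrite asboolT //; apply: z3_3_form_ratio.
Qed.

Lemma kind_z3_4 : kind (z3_4 K) = 4%N.
Proof.
rewrite /kind asboolT /=; last by prove_skew_commute.
rewrite asboolT /=; last by prove_skew_commute.
rewrite asboolT /=; last by prove_skew_commute.
by rewrite asboolT //; prove_skew_commute.
Qed.

Lemma kind_z3_5 : kind (z3_5 K) = 5%N.
Proof.
rewrite /kind asboolT /=; last by prove_skew_commute.
rewrite asboolF /=; last by refute_skew_commute o0 o1 o2.
by rewrite asboolF //; refute_skew_commute o1 o1 o0.
Qed.

Lemma kind_z3_7 a : kind (z3_7 a : superalgebra K) = 7%N.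
Proof.
rewrite /kind asboolT /=; last by prove_skew_commute.
rewrite asboolF /=; last by refute_skew_commute o0 o1 o2.
by rewrite asboolT //; prove_skew_commute.
Qed.

Lemma kind_z3_8 : kind (z3_8 K) = 8%N.
Proof.
rewrite /kind asboolT /=; last by prove_skew_commute.
rewrite asboolT /=; last by prove_skew_commute.
by rewrite asboolF //; refute_skew_commute o0 o1 o2.
Qed.

Lemma kind_z3_9 : kind (z3_9 K) = 9%N.
Proof. by rewrite /kind asboolF //; refute_skew_commute o0 o0 o1. Qed.

(** At e_1, f_1 the law reads a f_2 = b f_2. *)
Lemma z3_7_skew_commute_inj (a b : K) :
  skew_commute (z3_7 a) false true 1 b -> a = b.
Proof.
move=> /(_ (delta_mx 0 o0) (delta_mx 0 o1)) h.
have := h (delta_table_part _ erefl) (delta_table_part _ erefl).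
rewrite /= /table_mul !big_cons !big_nil /= => /rowP/(_ o2).
by rewrite !mxE /= ?(mulr0, mul0r, mulr1, mul1r, addr0, add0r).
Qed.

Lemma z3_7_skew_commute (a : K) : skew_commute (z3_7 a) false true 1 a.
Proof. prove_skew_commute. Qed.

(** Both entries have the kind of [Z], so only pairs of equal kind survive. Within a family, the
    parameter of one entry is a law that passes through [Z] to the other. *)
Lemma listed_iso_inj (Z S S' : superalgebra K) : listed S -> listed S' ->
  super_iso Z S -> super_iso Z S' -> S = S'.
Proof.
move=> lS lS' ZS ZS'.
have : kind S = kind S' by rewrite -(super_iso_kind ZS) (super_iso_kind ZS').
have kindE := (kind_z3_1, kind_z3_2, kind_z3_3, kind_z3_4, kind_z3_5,
  kind_z3_7, kind_z3_8, kind_z3_9).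
case: lS ZS => [a||||||a||] ZS; case: lS' ZS' => [b||||||b||] ZS';
  rewrite ?z3_6_7 ?kindE // ?z3_6_7 in ZS ZS' * => _.
- congr z3_1; apply: z3_1_form_ratio_inj.
  apply: super_iso_form_ratio ZS _.
  exact: (super_iso_form_ratio (super_iso_sym ZS') (@z3_1_form_ratio b)).
(* These are the pairs from [z3_6] and [z3_7], with [z3_6] rewritten as [z3_7 0]. *)
all: congr z3_7; apply: z3_7_skew_commute_inj.
all: apply: super_iso_skew_commute ZS _.
all: exact: (super_iso_skew_commute (super_iso_sym ZS') (@z3_7_skew_commute _)).
Qed.
End Tables.

(** * Graded bases, planes and ideals *)

Section Bases.
Variable K : fieldType.
Implicit Types Z : superalgebra K.

(** The map [h] sending a row to the combination of the [b i] with its entries as coefficients is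
    injective by freeness and surjective by dimension; the isomorphism wanted is its inverse. *)
Lemma basis_super_iso Z (n : nat) (is_odd : pred 'I_n) (T : seq (entry K n))
    (g : all (fun t => is_odd (e_res t) ==
       is_odd (e_left t) (+) is_odd (e_right t)) T) (b : 'I_n -> Z) :
  \dim {:Z} = n ->
  (forall c : 'I_n -> K, \sum_i c i *: b i = 0 -> forall i, c i = 0) ->
  (forall i, b i \in part Z (is_odd i)) ->
  (forall i j, b i ** b j =
     \sum_(t <- T | (e_left t == i) && (e_right t == j))
       e_coef t *: b (e_res t)) ->
  super_iso Z (table_superalgebra g).
Proof.
move=> dimZ bfree bpart bM; apply: super_iso_sym.
pose h (x : 'rV[K]_n) : Z := \sum_i x 0 i *: b i.
have h_lin : linear h.
  move=> a x y; rewrite /h scaler_sumr -big_split /=; apply: eq_bigr => i _.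
  by rewrite !mxE scalerDl scalerA.
pose HL := GRing.isLinear.Build _ _ _ _ h h_lin.
pose hl : {linear 'rV[K]_n -> Z} := HB.pack h HL.
pose f : 'Hom(table_superalgebra g, Z) := linfun hl.
have fE x : f x = h x by rewrite lfunE.
have finj : lker f == 0%VS.
  apply/lker0P => x y /eqP; rewrite -subr_eq0 -linearB /= fE => /eqP/bfree h0.
  by apply/rowP => i; have /eqP := h0 i; rewrite !mxE subr_eq0 => /eqP.
have fsurj : (f @: fullv)%VS = fullv.
  apply/eqP; rewrite eqEdim subvf dimZ limg_dim_eq.
    by rewrite dimvf /dim /= mul1n.
  by rewrite (eqP finj) capv0.
have fM x y : f (x ** y) = f x ** f y.
  rewrite !fE {2 3}/h linear_sumlz /=.
  under eq_bigr => i _ do rewrite linearZl_LR linear_sumr /=.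
  under eq_bigr => i _ do under eq_bigr => j _ do rewrite linearZr_LR /= bM.
  rewrite -[h _]/(hl _) linear_sum /=.
  have hd k : h 'e_k = b k.
    rewrite /h (bigD1 k) //= mxE !eqxx scale1r big1 ?addr0 // => l /negPf lk.
    by rewrite mxE lk andbF scale0r.
  under [RHS]eq_bigr => i _.
    rewrite scaler_sumr; under eq_bigr => j _ do
      rewrite scalerA scaler_sumr big_mkcond.
    rewrite exchange_big; over.
  rewrite [RHS]exchange_big; apply: eq_bigr => t _ /=.
  rewrite -[h _]/(hl _) linearZ /= hd.
  (* Only the index pair [(e_left t, e_right t)] matches the entry [t]. *)
  rewrite (bigD1 (e_left t)) //= (bigD1 (e_right t)) //= !eqxx scalerA.
  rewrite big1 ?big1 ?addr0 // => i.
    move=> /negPf li; rewrite big1 // => j _.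
    by rewrite eq_sym li.
  by move=> /negPf ri; rewrite (eq_sym _ i) ri andbF.
have fpart i x : x \in table_part is_odd T i -> f x \in part Z i.
  move=> /table_partP x0; rewrite fE; apply: memv_suml => k _.
  have [<-|/x0->] := eqVneq (is_odd k) i; last by rewrite scale0r mem0v.
  exact/memvZ/bpart.
exists f; split=> //.
  exists (f^-1)%VF; first exact: lker0_lfunK.
  move=> z; have /memv_imgP[x _ ->] : z \in (f @: fullv)%VS.
    by rewrite fsurj memvf.
  by rewrite lker0_lfunK.
move=> i; apply/eqP; rewrite eqEsubv; apply/andP; split.
  by apply/subvP => _ /memv_imgP[x xi ->]; apply: fpart.
apply/subvP => z zi.
have /memv_imgP[x _ zx] : z \in (f @: fullv)%VS by rewrite fsurj memvf.
have /memv_addP[u ui [v vi xuv]] :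
    x \in (table_part is_odd T i + table_part is_odd T (~~ i))%VS.
  by case: i {zi}; rewrite ?(addvC (table_part _ _ true)) table_part_sum memvf.
rewrite zx xuv linearD /=.
(* The component [v] of the wrong parity has its image in both parts, so [f v] vanishes. *)
have fv0 : f v \in (part Z false :&: part Z true)%VS.
  have fvi : f v \in part Z i.
    have -> : f v = z - f u by rewrite zx xuv linearD /= addrC addKr.
    by rewrite memvB // fpart.
  have := fpart _ _ vi; rewrite memv_cap.
  by case: i fvi {zi ui vi} => -> ->.
move: fv0; rewrite part_cap memv0 => /eqP->; rewrite addr0.
exact: memv_img.
Qed.

Definition indep2 (V : vectType K) (u v : V) : Prop :=
  forall a c, a *: u + c *: v = 0 -> a = 0 /\ c = 0.

Lemma indep2_notin_line (V : vectType K) (u v : V) :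
  u != 0 -> v \notin <[u]>%VS -> indep2 u v.
Proof.
move=> u0 vu a c /eqP; rewrite addr_eq0 => /eqP acuv.
have c0 : c = 0.
  apply: contraNeq vu => c0; apply/vlineP; exists (- (c^-1 * a)).
  by rewrite scaleNr -scalerA acuv scalerN opprK scalerA mulVf // scale1r.
split=> //; move/eqP: acuv; rewrite c0 scale0r oppr0 scaler_eq0 (negPf u0).
by rewrite orbF => /eqP.
Qed.

Lemma indep2_span (V : vectType K) (U : {vspace V}) (u v x : V) :
  \dim U = 2%N -> u \in U -> v \in U -> indep2 u v -> x \in U ->
  exists a c, x = a *: u + c *: v.
Proof.
move=> dimU uU vU uv xU.
have u0 : u != 0.
  apply/eqP => u0; have [] := uv 1 0; first by rewrite u0 scaler0 scale0r addr0.
  by move/eqP; rewrite oner_eq0.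
have suv : (<[u]> + <[v]> <= U)%VS by rewrite subv_add -!memvE uU vU.
suff eqU : (<[u]> + <[v]>)%VS = U.
  move: xU; rewrite -eqU => /memv_addP[_ /vlineP[a ->] [_ /vlineP[c ->] ->]].
  by exists a, c.
apply/eqP; rewrite eqEdim suv dimU.
have -> : 2%N = (\dim <[u]>%VS).+1 by rewrite dim_vline u0.
(* If adding [v] did not raise the dimension, [v] would lie on the line of [u]. *)
rewrite ltnNge; apply/negP => le_dim.
have : <[u]>%VS == (<[u]> + <[v]>)%VS by rewrite eqEdim addvSl.
move=> /eqP eq_uv; have : v \in <[u]>%VS.
  by rewrite eq_uv -{1}[v]add0r memv_add ?mem0v ?memv_line.
move=> /vlineP[k vk]; have [] := uv k (-1).
  by rewrite vk scaleN1r subrr.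
by move=> _ /eqP; rewrite oppr_eq0 oner_eq0.
Qed.

Lemma indep2_scale (V : vectType K) (u v : V) (a b : K) :
  a != 0 -> b != 0 -> indep2 u v -> indep2 (a *: u) (b *: v).
Proof.
move=> a0 b0 uv c d; rewrite !scalerA => /uv[/eqP + /eqP +].
by rewrite !mulf_eq0 (negPf a0) (negPf b0) !orbF => /eqP-> /eqP->.
Qed.

Lemma indep2_eq (V : vectType K) (u v : V) (a b c d : K) :
  indep2 u v -> a *: u + b *: v = c *: u + d *: v -> a = c /\ b = d.
Proof.
move=> uv eq_ab; have [] := uv (a - c) (b - d).
  by rewrite !scalerBl addrACA -opprD eq_ab subrr.
by split; apply/eqP; rewrite -subr_eq0; apply/eqP.
Qed.

Lemma dim1_line (V : vectType K) (U : {vspace V}) :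
  \dim U = 1%N -> exists2 u, u != 0 & U = <[u]>%VS.
Proof.
move=> dimU; have u0 : vpick U != 0 by rewrite vpick0 -dimv_eq0 dimU.
exists (vpick U) => //; apply/esym/eqP.
by rewrite eqEdim -memvE memv_pick dimU dim_vline u0.
Qed.

Lemma dim2_notin (V : vectType K) (U : {vspace V}) (u : V) :
  \dim U = 2%N -> exists2 v, v \in U & v \notin <[u]>%VS.
Proof.
move=> dimU; apply/subvPn; apply/negP => /dimvS.
by rewrite dimU dim_vline; case: (u != 0).
Qed.

Lemma dim2_indep2 (V : vectType K) (U : {vspace V}) (u : V) :
  \dim U = 2%N -> u != 0 -> exists2 v, v \in U & indep2 u v.
Proof.
move=> dimU u0; have [v vU vu] := dim2_notin u dimU.
by exists v => //; apply: indep2_notin_line.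
Qed.

Lemma dim_parts Z : (\dim (part Z false) + \dim (part Z true))%N = \dim {:Z}.
Proof. by rewrite -dimv_disjoint_sum ?part_sum ?part_cap. Qed.

Lemma part_eq0 Z (x y : Z) :
  x \in part Z false -> y \in part Z true -> x + y = 0 -> x = 0 /\ y = 0.
Proof.
move=> x0 y1 /eqP; rewrite addr_eq0 => /eqP xy.
have : x \in (part Z false :&: part Z true)%VS.
  by rewrite memv_cap x0 xy memvN.
by rewrite part_cap memv0 => /eqP x00; move: xy; rewrite x00 => /esym/eqP;
  rewrite oppr_eq0 => /eqP.
Qed.

(** By [part_eq0], a homogeneous family is free once its even and odd members are separately
    free. *)
Lemma super_iso_dim12 Z (e f1 f2 : Z) (T : seq (entry K 3))
    (b := fun i : 'I_3 => [:: e; f1; f2]`_i) g :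
  \dim {:Z} = 3%N -> e \in part Z false -> e != 0 ->
  f1 \in part Z true -> f2 \in part Z true -> indep2 f1 f2 ->
  (forall i j, b i ** b j =
     \sum_(t <- T | (e_left t == i) && (e_right t == j))
       e_coef t *: b (e_res t)) ->
  super_iso Z (@table_superalgebra K 3 (fun i : 'I_3 => 0 < i)%N T g).
Proof.
move=> dimZ e0 eN f11 f21 f12 bM.
apply: (basis_super_iso g dimZ (b := b)) => //.
  move=> c; rewrite sum3E -addrA /= => /part_eq0[];
    rewrite ?memvZ ?memvD ?memvZ //.
  move=> /eqP; rewrite scaler_eq0 (negPf eN) orbF => /eqP c0 /f12[c1 c2].
  exact: ord3_ind.
exact: ord3_ind.
Qed.

Lemma super_iso_dim21 Z (e1 e2 f : Z) (T : seq (entry K 3))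
    (b := fun i : 'I_3 => [:: e1; e2; f]`_i) g :
  \dim {:Z} = 3%N -> e1 \in part Z false -> e2 \in part Z false ->
  indep2 e1 e2 -> f \in part Z true -> f != 0 ->
  (forall i j, b i ** b j =
     \sum_(t <- T | (e_left t == i) && (e_right t == j))
       e_coef t *: b (e_res t)) ->
  super_iso Z (@table_superalgebra K 3 (fun i : 'I_3 => 1 < i)%N T g).
Proof.
move=> dimZ e10 e20 e12 f1 fN bM.
apply: (basis_super_iso g dimZ (b := b)) => //.
  move=> c; rewrite sum3E /= => /part_eq0[];
    rewrite ?memvZ ?memvD ?memvZ //.
  move=> /e12[c0 c1] /eqP; rewrite scaler_eq0 (negPf fN) orbF => /eqP c2.
  exact: ord3_ind.
exact: ord3_ind.
Qed.

Lemma smulDl Z (x y z : Z) : (x + y) ** z = x ** z + y ** z.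
Proof. exact: linearDl. Qed.

Lemma smulDr Z (x y z : Z) : x ** (y + z) = x ** y + x ** z.
Proof. exact: linearDr. Qed.

Lemma smulZl Z (c : K) (x y : Z) : (c *: x) ** y = c *: (x ** y).
Proof. exact: linearZl_LR. Qed.

Lemma smulZr Z (c : K) (x y : Z) : x ** (c *: y) = c *: (x ** y).
Proof. exact: linearZr_LR. Qed.

Lemma smul0l Z (x : Z) : 0 ** x = 0.
Proof. exact: linear0l. Qed.

Lemma smul0r Z (x : Z) : x ** 0 = 0.
Proof. exact: linear0r. Qed.

Lemma graded_idealD Z (U W : {vspace Z}) :
  (U <= part Z false)%VS -> (W <= part Z true)%VS ->
  (forall x y : Z, x \in (U + W)%VS ->
     x ** y \in (U + W)%VS /\ y ** x \in (U + W)%VS) ->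
  graded_ideal (U + W)%VS.
Proof.
move=> U0 W1 UWM; split=> //; apply/eqP; rewrite eqEsubv; apply/andP; split.
  by apply: addvS; rewrite subv_cap ?U0 ?W1 ?addvSl ?addvSr.
by rewrite subv_add !capvSl.
Qed.

(** Here both parts are themselves graded ideals; this is the usual way to contradict non-splitness
    below. *)
Lemma split_parts Z :
  part Z false != 0%VS -> part Z true != 0%VS ->
  (forall x y : Z, x \in part Z false -> y \in part Z true ->
     x ** y = 0 /\ y ** x = 0) ->
  (forall x y : Z, x \in part Z true -> y \in part Z true -> x ** y = 0) ->
  split_super Z.
Proof.
move=> n0 n1 h01 h11; exists (part Z false), (part Z true).
split; last by rewrite part_sum part_cap.
split=> //.
- rewrite -[part Z false]addv0; apply: graded_idealD; rewrite ?subvv ?sub0v //.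
  rewrite addv0 => x y x0.
  have : y \in (part Z false + part Z true)%VS by rewrite part_sum memvf.
  move=> /memv_addP[u u0 [v v1 ->]]; rewrite smulDl smulDr.
  have [-> ->] := h01 _ _ x0 v1; rewrite !addr0.
  by split; [apply: part_mul x0 u0|apply: part_mul u0 x0].
- rewrite -[part Z true]add0v; apply: graded_idealD; rewrite ?subvv ?sub0v //.
  rewrite add0v => x y x1.
  have : y \in (part Z false + part Z true)%VS by rewrite part_sum memvf.
  move=> /memv_addP[u u0 [v v1 ->]]; rewrite smulDl smulDr.
  by have [-> ->] := h01 _ _ u0 x1; rewrite !h11 // addr0 mem0v.
Qed.

End Bases.

Section Classification.
Variables (K : numClosedFieldType) (Z : superalgebra K).
Hypothesis Z_zinbiel : zinbiel_super Z.
Hypothesis Z_dim : \dim {:Z} = 3%N.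
Hypothesis Z_nonsplit : ~ split_super Z.

Let Z0 := part Z false.
Let Z1 := part Z true.

Ltac check_table :=
  let i := fresh in let j := fresh in
  move=> i j; elim/ord3_ind: i; elim/ord3_ind: j;
  rewrite !big_cons ?big_nil /= ?addr0 ?scale1r ?scaleN1r.

(** * Trivial action: bilinear forms on the odd plane *)

(** The Gram matrix has rows (1, 0) and (r, s). If [r = 0] the form is symmetric, and a nonzero [s]
    is scaled to 1 by a square root. Otherwise dividing [w] by [r] gives the matrix of
    [z3_1 (s / r ^+ 2)]. *)
Lemma listed_orthogonal (e v w : Z) (r s : K) :
  e \in Z0 -> e != 0 -> v \in Z1 -> w \in Z1 -> indep2 v w ->
  [/\ e ** e = 0, e ** v = 0, v ** e = 0, e ** w = 0 & w ** e = 0] ->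
  [/\ v ** v = e, v ** w = 0, w ** v = r *: e & w ** w = s *: e] ->
  exists S, listed S /\ super_iso Z S.
Proof.
move=> e0 eN v1 w1 vw [ee ev ve ew we] [vv vw0 wv ww].
have indepS c : c != 0 -> indep2 v (c *: w).
  by move=> c0; rewrite -[v]scale1r; apply: indep2_scale; rewrite ?oner_eq0.
have [r0|r0] := eqVneq r 0.
  have [s0|s0] := eqVneq s 0.
    exists (z3_3 K); split; first by constructor.
    apply: (@super_iso_dim12 _ _ e v w) => //; check_table => //.
    - by rewrite wv r0 scale0r.
    - by rewrite ww s0 scale0r.
  have q0 : (sqrtC s)^-1 != 0 by rewrite invr_eq0 sqrtC_eq0.
  exists (z3_2 K); split; first by constructor.
  apply: (@super_iso_dim12 _ _ e v ((sqrtC s)^-1 *: w)) => //;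
    rewrite ?memvZ //.
    exact: indepS.
  check_table; rewrite ?smulZl ?smulZr //.
  - by rewrite ew scaler0.
  - by rewrite vw0 scaler0.
  - by rewrite we scaler0.
  - by rewrite wv r0 scale0r scaler0.
  - by rewrite ww !scalerA -invfM -expr2 sqrtCK mulVf // scale1r.
exists (z3_1 (s / r ^+ 2)); split; first by constructor.
apply: (@super_iso_dim12 _ _ e v (r^-1 *: w)) => //; rewrite ?memvZ //.
  by apply: indepS; rewrite invr_eq0.
check_table; rewrite ?smulZl ?smulZr //.
- by rewrite ew scaler0.
- by rewrite vw0 scaler0.
- by rewrite we scaler0.
- by rewrite wv scalerA mulVf // scale1r.
- by rewrite ww !scalerA; congr (_ *: _); field.
Qed.

(** With [v ** v] as even basis vector and [v ** w = q *: (v ** v)], the vector [w - q *: v]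
    satisfies [v ** (w - q *: v) = 0], as [listed_orthogonal] requires. *)
Lemma listed_nonalternating (v w : Z) :
  \dim Z0 = 1%N -> v \in Z1 -> w \in Z1 -> indep2 v w -> v ** v != 0 ->
  (forall x y : Z, x \in Z0 -> y \in Z0 -> x ** y = 0) ->
  (forall x y : Z, x \in Z0 -> y \in Z1 -> x ** y = 0 /\ y ** x = 0) ->
  exists S, listed S /\ super_iso Z S.
Proof.
move=> dim0 v1 w1 vw vvN h00 h01.
have e0 : v ** v \in Z0 by apply: (part_mul v1 v1).
have eqZ0 : Z0 = <[v ** v]>%VS.
  apply/esym/eqP; rewrite eqEdim -memvE e0 dim0 dim_vline.
  by rewrite (negPf vvN).
have ex x y : x \in Z1 -> y \in Z1 -> exists k, x ** y = k *: (v ** v).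
  by move=> x1 y1; apply/vlineP; rewrite -eqZ0; apply: (part_mul x1 y1).
have [q vwq] := ex _ _ v1 w1; have [r wvr] := ex _ _ w1 v1.
have w'1 : w - q *: v \in Z1 by rewrite memvB // memvZ.
have [s w's] := ex _ _ w'1 w'1.
apply: (@listed_orthogonal (v ** v) v (w - q *: v) (r - q) s) => //.
- move=> a b; rewrite scalerBr scalerA addrCA -scalerBl addrC => /vw[+ b0].
  by rewrite b0 mul0r subr0.
- have [-> ->] := h01 _ _ e0 v1; have [-> ->] := h01 _ _ e0 w'1.
  by rewrite h00.
- split=> //; rewrite -scaleNr ?smulDr ?smulDl ?smulZr ?smulZl ?vwq ?wvr.
    by rewrite -scalerDl subrr scale0r.
  by rewrite -scalerDl.
Qed.

(** What remains is an alternating form on a plane: it is zero, and then [Z] splits, or [f ** g]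
    spans the even part and gives [z3_4]. *)
Lemma listed_trivial_action :
  \dim Z0 = 1%N -> \dim Z1 = 2%N ->
  (forall x y : Z, x \in Z0 -> y \in Z0 -> x ** y = 0) ->
  (forall x y : Z, x \in Z0 -> y \in Z1 -> x ** y = 0 /\ y ** x = 0) ->
  exists S, listed S /\ super_iso Z S.
Proof.
move=> dim0 dim1 h00 h01.
case: (pselect (exists2 v, v \in Z1 & v ** v != 0)) => [[v v1 vvN]|alt].
  have vN : v != 0 by apply: contra_neq vvN => ->; rewrite smul0l.
  have [w w1 vw] := dim2_indep2 dim1 vN.
  exact: (listed_nonalternating dim0 v1 w1 vw vvN).
have {}alt v : v \in Z1 -> v ** v = 0.
  by move=> v1; apply/eqP/negPn/negP => vvN; apply: alt; exists v.
have skew x y : x \in Z1 -> y \in Z1 -> y ** x = - (x ** y).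
  move=> x1 y1; apply/eqP; rewrite -addr_eq0 addrC.
  by have := alt _ (memvD x1 y1); rewrite smulDl !smulDr !alt // add0r addr0;
    move=> ->.
have fN : vpick Z1 != 0 by rewrite vpick0 -dimv_eq0 dim1.
have f1 := memv_pick Z1; set f := vpick Z1 in fN f1.
have [g g1 fg] := dim2_indep2 dim1 fN.
have [fg0|fgN] := eqVneq (f ** g) 0.
  exfalso; apply: Z_nonsplit; apply: split_parts => //.
  - by rewrite -dimv_eq0 dim0.
  - by rewrite -dimv_eq0 dim1.
  move=> x y x1 y1.
  have [a [b ->]] := indep2_span dim1 f1 g1 fg x1.
  have [c [d ->]] := indep2_span dim1 f1 g1 fg y1.
  rewrite smulDl !smulDr !smulZl !smulZr (skew f g) // fg0 !alt //.
  by rewrite oppr0 !scaler0 !addr0.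
have e0 : f ** g \in Z0 := part_mul f1 g1.
have [ef fe] := h01 _ _ e0 f1; have [eg ge] := h01 _ _ e0 g1.
exists (z3_4 K); split; first by constructor.
apply: (@super_iso_dim12 _ _ (f ** g) f g) => //; check_table => //;
  by rewrite ?(h00 (f ** g)) ?(alt f) ?(alt g) // (skew f g).
Qed.

(** * The Zinbiel identity by parity, and squares of even vectors *)

(** The sign depends only on the last two factors: it is plus if either is even ([zin0l], [zin0r])
    and minus if both are odd ([zin11]). *)
Lemma zin0l i k (x y z : Z) : x \in part Z i -> y \in Z0 -> z \in part Z k ->
  x ** y ** z = x ** (y ** z + z ** y).
Proof. by move=> xi y0 zk; rewrite (Z_zinbiel xi y0 zk) expr0 scale1r. Qed.

Lemma zin0r i j (x y z : Z) : x \in part Z i -> y \in part Z j -> z \in Z0 ->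
  x ** y ** z = x ** (y ** z + z ** y).
Proof.
by move=> xi yj z0; rewrite (Z_zinbiel xi yj z0) andbF expr0 scale1r.
Qed.

Lemma zin11 i (x y z : Z) : x \in part Z i -> y \in Z1 -> z \in Z1 ->
  x ** y ** z = x ** (y ** z - z ** y).
Proof. by move=> xi y1 z1; rewrite (Z_zinbiel xi y1 z1) expr1 scaleN1r. Qed.

(** The identity for x, x, x gives k xx = 2k xx, so [k = 0] or [x ** x = 0]. *)
Lemma even_sq (x : Z) (k : K) : x \in Z0 -> x ** x = k *: x -> x ** x = 0.
Proof.
move=> x0 xx; have := zin0l x0 x0 x0.
rewrite /= smulDr xx smulZl smulZr xx => /eqP.
rewrite -subr_eq0 opprD addNKr oppr_eq0 !scaler_eq0 orbA orbb.
by case/orP => /eqP ->; rewrite ?scale0r ?scaler0.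
Qed.

Lemma even_line_mul (x y : Z) :
  \dim Z0 = 1%N -> x \in Z0 -> y \in Z0 -> x ** y = 0.
Proof.
move=> /dim1_line[e eN eqZ0]; have e0 : e \in Z0 by rewrite eqZ0 memv_line.
have /vlineP[k /(even_sq e0) ee] : e ** e \in <[e]>%VS.
  by rewrite -eqZ0; apply: (part_mul e0 e0).
rewrite eqZ0 => /vlineP[a ->] /vlineP[b ->].
by rewrite smulZl smulZr ee !scaler0.
Qed.


(** * Nontrivial action of an even line on an odd plane *)

(** Right multiplication by [e] squares to zero, so [f], [g] is a basis of the odd plane. Only ef =
    cg, fe = g and ff = pe can be nonzero, and (ff)f = 0 forces pc = 0: the case [p = 0] is
    [z3_7 c], the other is [z3_5]. *)
Lemma listed_right_action (e f g : Z) :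
  \dim Z0 = 1%N -> \dim Z1 = 2%N ->
  e \in Z0 -> f \in Z1 -> f ** e = g -> g != 0 ->
  exists S, listed S /\ super_iso Z S.
Proof.
move=> dim0 dim1 e0 f1 fe feN.
have h00 (x y : Z) := @even_line_mul x y dim0.
have eN : e != 0 by apply: contra_neq feN => eq0; rewrite -fe eq0 smul0r.
have eqZ0 : Z0 = <[e]>%VS.
  apply/esym/eqP; rewrite eqEdim -memvE e0 dim0 dim_vline.
  by rewrite (negPf eN).
have g1 : g \in Z1 by rewrite -fe; apply: (part_mul f1 e0).
have ge : g ** e = 0.
  by rewrite -fe (zin0l f1 e0 e0) (h00 e e) // addr0 smul0r.
have fg : indep2 f g.
  move=> a c acfg; have /eqP := congr1 (fun x => x ** e) acfg.
  rewrite smul0l smulDl !smulZl ge scaler0 addr0 fe scaler_eq0 (negPf feN) orbF.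
  move=> /eqP a0; move: acfg; rewrite a0 scale0r add0r => /eqP.
  by rewrite scaler_eq0 (negPf feN) orbF => /eqP.
(* Both (ex)e and (ee)x expand to e(xe + ex), and ee = 0. *)
have eZe x : x \in Z1 -> e ** x ** e = 0.
  move=> x1; rewrite (zin0r e0 x1 e0) addrC.
  by rewrite -(zin0l e0 e0 x1) (h00 e e) // smul0l.
(* So [e ** x] lies in the kernel of right multiplication by [e] on the odd plane, which is the line
   of [g]. *)
have eZ x : x \in Z1 -> exists c, e ** x = c *: g.
  move=> x1; have [a [c ex]] := indep2_span dim1 f1 g1 fg (part_mul e0 x1).
  have /eqP := eZe x x1; rewrite ex smulDl !smulZl ge scaler0 addr0 fe.
  by rewrite scaler_eq0 (negPf feN) orbF => /eqP->; exists c;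
    rewrite scale0r add0r.
have [c ef] := eZ f f1.
have eg : e ** g = 0.
  have [q eg] := eZ g g1; have /eqP := zin0l e0 e0 g1.
  rewrite (h00 e e) // smul0l ge addr0 eg smulZr eg scalerA eq_sym.
  by rewrite scaler_eq0 (negPf feN) orbF mulf_eq0 orbb => /eqP->;
    rewrite scale0r.
have g_g : g ** g = 0.
  by rewrite -{1}fe (zin0l f1 e0 g1) eg ge addr0 smul0r.
(* (fe)f = f(ef + fe) = (ff)e is a product of two even vectors. *)
have gf : g ** f = 0.
  rewrite -{1}fe (zin0l f1 e0 f1) addrC.
  rewrite -(zin0r f1 f1 e0) h00 //.
  exact: (part_mul f1 f1).
have [p ff] : exists p, f ** f = p *: e.
  by apply/vlineP; rewrite -eqZ0; apply: (part_mul f1 f1).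
(* In (ff)g = f(fg - gf) the left side is p eg = 0 and the right side is q fe = qg. *)
have fg0 : f ** g = 0.
  have [q fgE] : exists q, f ** g = q *: e.
    by apply/vlineP; rewrite -eqZ0; apply: (part_mul f1 g1).
  have /eqP := zin11 f1 f1 g1.
  rewrite ff smulZl eg gf scaler0 subr0 fgE smulZr fe eq_sym.
  by rewrite scaler_eq0 (negPf feN) orbF => /eqP->; rewrite scale0r.
have /eqP := zin11 f1 f1 f1.
rewrite subrr smul0r ff smulZl ef scalerA.
rewrite scaler_eq0 (negPf feN) orbF mulf_eq0.
have [p0 _|pN /= /eqP c0] := eqVneq p 0.
  exists (z3_7 c); split; first by constructor.
  apply: (@super_iso_dim12 _ _ e f g) => //; check_table;
    by rewrite ?(h00 e e) ?ff ?p0 ?scale0r.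
exists (z3_5 K); split; first by constructor.
(* Scaling [e] and [g] by [p] makes ff the even basis vector and keeps fe = g. *)
apply: (@super_iso_dim12 _ _ (p *: e) f (p *: g)) => //; rewrite ?memvZ //.
- by rewrite scaler_eq0 negb_or pN.
- by rewrite -[f]scale1r; apply: indep2_scale; rewrite ?oner_eq0.
check_table; by rewrite ?smulZl ?smulZr ?(h00 e e) ?ef ?eg ?fe ?ge ?fg0 ?gf
  ?g_g ?ff ?c0 ?scale0r ?scaler0.
Qed.

(** Each product with [g] reduces by the identity to a product of even vectors or to zero. Finally
    ff = pe, and (ff)f = 0 gives pg = 0, so ff = 0 and only ef = g is left. *)
Lemma listed_left_action (e f g : Z) :
  \dim Z0 = 1%N -> \dim Z1 = 2%N ->
  (forall x y : Z, x \in Z0 -> y \in Z1 -> y ** x = 0) ->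
  e \in Z0 -> f \in Z1 -> e ** f = g -> g != 0 ->
  exists S, listed S /\ super_iso Z S.
Proof.
move=> dim0 dim1 h10 e0 f1 ef efN.
have h00 (x y : Z) := @even_line_mul x y dim0.
have eN : e != 0 by apply: contra_neq efN => eq0; rewrite -ef eq0 smul0l.
have eqZ0 : Z0 = <[e]>%VS.
  apply/esym/eqP; rewrite eqEdim -memvE e0 dim0 dim_vline.
  by rewrite (negPf eN).
have g1 : g \in Z1 by rewrite -ef; apply: (part_mul e0 f1).
have ff0 : f ** f \in Z0 := part_mul f1 f1.
have eg : e ** g = 0.
  have := zin0l e0 e0 f1.
  by rewrite (h00 e e) // smul0l (h10 e f) // addr0 ef.
have fg : indep2 f g.
  move=> a c acfg; have /eqP := congr1 (fun x => e ** x) acfg.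
  rewrite smul0r smulDr !smulZr eg scaler0 addr0 ef scaler_eq0 (negPf efN) orbF.
  move=> /eqP a0; move: acfg; rewrite a0 scale0r add0r => /eqP.
  by rewrite scaler_eq0 (negPf efN) orbF => /eqP.
have gf : g ** f = 0.
  by rewrite -{1}ef (zin11 e0 f1 f1) subrr smul0r.
have g_g : g ** g = 0.
  rewrite -{1}ef (zin11 e0 f1 g1) h00 // memvB //.
    exact: (part_mul f1 g1).
  exact: (part_mul g1 f1).
have fg0 : f ** g = 0.
  have := zin0r f1 f1 e0.
  by rewrite h00 // (h10 e f) // add0r ef.
have [p ff] : exists p, f ** f = p *: e by apply/vlineP; rewrite -eqZ0.
have p0 : p = 0.
  have /eqP := zin11 f1 f1 f1.
  rewrite subrr smul0r ff smulZl ef.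
  by rewrite scaler_eq0 (negPf efN) orbF => /eqP.
exists (z3_8 K); split; first by constructor.
apply: (@super_iso_dim12 _ _ e f g) => //; check_table;
  by rewrite ?(h00 e e) ?(h10 e f) ?(h10 e g) ?ff ?p0 ?scale0r.
Qed.

Lemma listed_dim12 : \dim Z0 = 1%N -> \dim Z1 = 2%N ->
  exists S, listed S /\ super_iso Z S.
Proof.
move=> dim0 dim1.
case: (pselect (exists2 e, e \in Z0 & exists2 f, f \in Z1 & f ** e != 0)).
  by move=> [e e0 [f f1]]; apply: listed_right_action (erefl _).
move=> noR.
have h10 (x y : Z) : x \in Z0 -> y \in Z1 -> y ** x = 0.
  move=> x0 y1; apply/eqP/negPn/negP => yx; apply: noR.
  by exists x => //; exists y.
case: (pselect (exists2 e, e \in Z0 & exists2 f, f \in Z1 & e ** f != 0)).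
  by move=> [e e0 [f f1]]; apply: listed_left_action (erefl _).
move=> noL; apply: listed_trivial_action => // x y x0 y0.
  exact: even_line_mul.
split; last exact: h10.
by apply/eqP/negPn/negP => xy; apply: noL; exists x => //; exists y.
Qed.

(** * Even plane and odd line *)

(** Polarisation gives anticommutativity, hence (uv)w = u(vw + wv) = 0. If uv = au + cv were
    nonzero, (uv)v = a uv and (uv)u = -c uv would force a = c = 0. *)
Lemma even_plane_null (x y : Z) : \dim Z0 = 2%N ->
  (forall u : Z, u \in Z0 -> u ** u = 0) ->
  x \in Z0 -> y \in Z0 -> x ** y = 0.
Proof.
move=> dim0 alt.
have skew u v : u \in Z0 -> v \in Z0 -> v ** u = - (u ** v).
  move=> u0 v0; apply/eqP; rewrite -addr_eq0 addrC.
  by have := alt _ (memvD u0 v0); rewrite smulDl !smulDr !alt // add0r addr0;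
    move=> ->.
have nil3 u v w : u \in Z0 -> v \in Z0 -> w \in Z0 -> u ** v ** w = 0.
  move=> u0 v0 w0; rewrite (zin0l u0 v0 w0) (skew v w) //.
  by rewrite subrr smul0r.
have uN : vpick Z0 != 0 by rewrite vpick0 -dimv_eq0 dim0.
have u0 := memv_pick Z0; set u := vpick Z0 in uN u0.
have [v v0 uv] := dim2_indep2 dim0 uN.
have uv0 : u ** v = 0.
  have [a [c uvE]] := indep2_span dim0 u0 v0 uv (part_mul u0 v0).
  apply/eqP/negPn/negP => uvN.
  have /eqP := nil3 u v v u0 v0 v0.
  rewrite {1}uvE smulDl !smulZl alt // scaler0 addr0 scaler_eq0.
  rewrite (negPf uvN) orbF.
  have := nil3 u v u u0 v0 u0.
  rewrite {1}uvE smulDl !smulZl alt // scaler0 add0r skew // scalerN => /eqP.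
  rewrite oppr_eq0 scaler_eq0 (negPf uvN) orbF => /eqP c0 /eqP a0.
  by move: uvN; rewrite uvE a0 c0 !scale0r addr0 eqxx.
move=> /(indep2_span dim0 u0 v0 uv)[a [b ->]].
move=> /(indep2_span dim0 u0 v0 uv)[c [d ->]].
rewrite smulDl !smulDr !smulZl !smulZr (skew u v) // uv0 !alt //.
by rewrite oppr0 !scaler0 !addr0.
Qed.

(** With y = xx, the identity gives yx = 2xy, yy = 3x(xy) and (xy)x = 3x(xy). Writing xy = ax + by
    and comparing coefficients in the last equation gives ab = 0 and b^2 = -2a, so xy = 0. *)
Lemma even_plane_nonnull (x : Z) : \dim Z0 = 2%N ->
  x \in Z0 -> indep2 x (x ** x) ->
  [/\ x ** (x ** x) = 0, x ** x ** x = 0 & x ** x ** (x ** x) = 0].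
Proof.
move=> dim0 x0; have y0 : x ** x \in Z0 := part_mul x0 x0.
move yE : (x ** x) => y xy; rewrite yE in y0.
have yx : y ** x = 2%:R *: (x ** y).
  by rewrite -{1}yE (zin0l x0 x0 x0) yE smulDr scaler_nat mulr2n.
have yy : y ** y = 3%:R *: (x ** (x ** y)).
  rewrite -{1}yE (zin0l x0 x0 y0) yx smulDr smulZr.
  by rewrite -{1}[_ ** _]scale1r -scalerDl; congr (_ *: _); ring.
have xyx : x ** y ** x = 3%:R *: (x ** (x ** y)).
  rewrite (zin0l x0 y0 x0) yx smulDr smulZr.
  by rewrite -{2}[x ** (_ ** _)]scale1r -scalerDl; congr (_ *: _); ring.
have [a [b xyE]] := indep2_span dim0 x0 y0 xy (part_mul x0 y0).
suff [a0 b0] : a = 0 /\ b = 0.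
  have xy0 : x ** y = 0 by rewrite xyE a0 b0 !scale0r addr0.
  by rewrite yx yy xy0 smul0r !scaler0.
have xxyE : x ** (x ** y) = (b * a) *: x + (a + b * b) *: y.
  rewrite {1}xyE smulDr !smulZr yE xyE scalerDr !scalerA addrCA -scalerDl.
  by [].
have xyxE : x ** y ** x = (b * (2%:R * a)) *: x + (a + b * (2%:R * b)) *: y.
  rewrite {1}xyE smulDl !smulZl yE yx xyE !scalerDr !scalerA addrCA -scalerDl.
  by rewrite !mulrA.
have [] : b * (2%:R * a) = 3%:R * (b * a) /\
          a + b * (2%:R * b) = 3%:R * (a + b * b).
  by apply: (indep2_eq xy); rewrite -xyxE xyx xxyE scalerDr !scalerA.
move=> /eqP; rewrite -subr_eq0 (_ : _ - _ = - (b * a)); last by ring.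
rewrite oppr_eq0 mulf_eq0 => /orP[/eqP->|/eqP->] /eqP.
  rewrite !mul0r !addr0 -subr_eq0 (_ : _ - _ = - 2%:R * a); last by ring.
  by rewrite mulf_eq0 oppr_eq0 pnatr_eq0 => /eqP.
rewrite !add0r -subr_eq0 (_ : _ - _ = - (b * b)); last by ring.
by rewrite oppr_eq0 mulf_eq0 orbb => /eqP.
Qed.

(** If xf = lf and fx = rf, then (xf)x = x(fx + xf) reads lr = lr + l^2. *)
Lemma even_act_left (x y : Z) : \dim Z1 = 1%N ->
  x \in Z0 -> y \in Z1 -> x ** y = 0.
Proof.
move=> /dim1_line[f fN eqZ1] x0; have f1 : f \in Z1 by rewrite eqZ1 memv_line.
have [l xf] : exists l, x ** f = l *: f.
  by apply/vlineP; rewrite -eqZ1; apply: (part_mul x0 f1).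
have [r fx] : exists r, f ** x = r *: f.
  by apply/vlineP; rewrite -eqZ1; apply: (part_mul f1 x0).
have l0 : l = 0.
  have /eqP := zin0r x0 f1 x0.
  rewrite xf smulZl fx smulDr !smulZr xf !scalerA -scalerDl -subr_eq0 -scalerBl.
  rewrite (_ : _ - _ = - (l * l)); last by ring.
  by rewrite scaler_eq0 (negPf fN) orbF oppr_eq0 mulf_eq0 orbb => /eqP.
rewrite eqZ1 => /vlineP[c ->].
by rewrite smulZr xf l0 scale0r scaler0.
Qed.

(** If fx = rf, then (fx)x = f(xx + xx) = 0 gives r^2 = 0. *)
Lemma even_act_right (x y : Z) : \dim Z1 = 1%N ->
  x \in Z0 -> (forall z : Z, z \in Z1 -> z ** (x ** x) = 0) ->
  y \in Z1 -> y ** x = 0.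
Proof.
move=> /dim1_line[f fN eqZ1] x0 xx0.
have f1 : f \in Z1 by rewrite eqZ1 memv_line.
have [r fx] : exists r, f ** x = r *: f.
  by apply/vlineP; rewrite -eqZ1; apply: (part_mul f1 x0).
have r0 : r = 0.
  have /eqP := zin0r f1 x0 x0.
  rewrite smulDr xx0 // addr0 fx smulZl fx scalerA scaler_eq0 (negPf fN) orbF.
  by rewrite mulf_eq0 orbb => /eqP.
rewrite eqZ1 => /vlineP[c ->].
by rewrite smulZl fx r0 scale0r scaler0.
Qed.

(** Were all even squares zero, only ff could be nonzero. If ff = 0 the two parts split [Z];
    otherwise an even [x] off the line of ff is annihilated by everything, and its line is
    complementary to the ideal spanned by ff and f. *)
Lemma even_plane_not_null : \dim Z0 = 2%N -> \dim Z1 = 1%N ->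
  ~ (forall u : Z, u \in Z0 -> u ** u = 0).
Proof.
move=> dim0 dim1 alt; apply: Z_nonsplit.
have h00 (x y : Z) := @even_plane_null x y dim0 alt.
have h01 (x y : Z) : x \in Z0 -> y \in Z1 -> x ** y = 0 by apply: even_act_left.
have h10 (x y : Z) : x \in Z0 -> y \in Z1 -> y ** x = 0.
  by move=> x0; apply: even_act_right => // z z1; rewrite alt // smul0r.
have [f fN eqZ1] := dim1_line dim1.
have f1 : f \in Z1 by rewrite eqZ1 memv_line.
have ff0 : f ** f \in Z0 := part_mul f1 f1.
have n0 : Z0 != 0%VS by rewrite -dimv_eq0 dim0.
have n1 : Z1 != 0%VS by rewrite -dimv_eq0 dim1.
have [ff|ffN] := eqVneq (f ** f) 0.
  apply: split_parts => // x y; first by move=> x0 y1; rewrite h01 // h10.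
  rewrite -/Z1 eqZ1 => /vlineP[a ->] /vlineP[c ->].
  by rewrite smulZl smulZr ff !scaler0.
have [x x0 xff] := dim2_notin (f ** f) dim0.
have xN : x != 0 by apply: contraNneq xff => ->; rewrite mem0v.
have prod (y z : Z) : y ** z \in <[f ** f]>%VS.
  have : y \in (Z0 + Z1)%VS by rewrite part_sum memvf.
  move=> /memv_addP[y0 y00 [y1 y11 ->]].
  have : z \in (Z0 + Z1)%VS by rewrite part_sum memvf.
  move=> /memv_addP[z0 z00 [z1 z11 ->]].
  rewrite smulDl !smulDr h00 // h01 // h10 // !add0r.
  move: y11 z11; rewrite eqZ1 => /vlineP[a ->] /vlineP[c ->].
  by rewrite smulZl smulZr !memvZ // memv_line.
have x_ann (y : Z) : x ** y = 0 /\ y ** x = 0.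
  have : y \in (Z0 + Z1)%VS by rewrite part_sum memvf.
  move=> /memv_addP[y0 y00 [y1 y11 ->]].
  rewrite smulDl smulDr (h00 x y0) ?(h00 y0 x) ?(h01 x y1) ?(h10 x y1) //.
  by rewrite addr0.
exists <[x]>%VS, (<[f ** f]> + Z1)%VS; split; first split.
- rewrite -[<[x]>%VS]addv0; apply: graded_idealD; rewrite ?sub0v -?memvE //.
  rewrite addv0 => _ y /vlineP[c ->]; rewrite smulZl smulZr.
  by have [-> ->] := x_ann y; rewrite scaler0 mem0v.
- apply: graded_idealD; rewrite ?subvv -?memvE // => y z _.
  by rewrite !(subvP (addvSl _ _)).
- by rewrite -dimv_eq0 dim_vline xN.
- apply: contra n1 => /eqP J0; rewrite -subv0 -J0; exact: addvSr.
have x0c : (<[x]> + <[f ** f]>)%VS = Z0.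
  apply/eqP; rewrite eqEsubv subv_add -!memvE x0 ff0 /=; apply/subvP => y y0.
  have ffx : indep2 (f ** f) x by apply: indep2_notin_line.
  have [a [c ->]] := indep2_span dim0 ff0 x0 ffx y0.
  by rewrite addrC memv_add ?memvZ ?memv_line.
split; first by rewrite addvA x0c part_sum.
apply/vspaceP => y; rewrite memv_cap memv0.
apply/andP/eqP => [[]|->]; last by rewrite !mem0v.
move=> /vlineP[a ->] /memv_addP[_ /vlineP[c ->] [z z1 axE]].
(* Comparing even components of a common element yields ax = c ff, against the choice of [x]. *)
have /part_eq0 : (a *: x - c *: (f ** f)) + (- z) = 0.
  by rewrite axE addrAC addrK subrr.
rewrite memvB ?memvZ // memvN => /(_ isT z1)[/eqP]; rewrite subr_eq0 => /eqP.
have [->|aN] := eqVneq a 0; first by rewrite scale0r.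
move=> ax; case/vlineP: xff; exists (a^-1 * c).
by rewrite -scalerA -ax scalerA mulVf // scale1r.
Qed.

(** Some even [x] has its square y off its line. The even part acts trivially on the odd line, and
    ff is a multiple of y: nonzero since [Z] does not split, and scaled to y by a square root. *)
Lemma listed_dim21 : \dim Z0 = 2%N -> \dim Z1 = 1%N ->
  exists S, listed S /\ super_iso Z S.
Proof.
move=> dim0 dim1.
case: (pselect (exists2 x, x \in Z0 & x ** x \notin <[x]>%VS)); last first.
  move=> null; exfalso; apply: (even_plane_not_null dim0 dim1) => u u0.
  case: (boolP (u ** u \in <[u]>%VS)) => [/vlineP[k]|uu]; first exact: even_sq.
  by exfalso; apply: null; exists u.
move=> [x x0 xxN].
have xN : x != 0 by apply: contraNneq xxN => ->; rewrite smul0l mem0v.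
have xy := indep2_notin_line xN xxN.
have y0 : x ** x \in Z0 := part_mul x0 x0.
have [xy0 yx0 yy0] := even_plane_nonnull dim0 x0 xy.
move yE : (x ** x) => y in xxN xy y0 xy0 yx0 yy0.
have h01 (u v : Z) : u \in Z0 -> v \in Z1 -> u ** v = 0 by apply: even_act_left.
(* The vector [y] comes first, as [y ** y = 0]; the case of [x] then follows from [x ** x = y]. *)
have y10 (v : Z) : v \in Z1 -> v ** y = 0.
  by apply: even_act_right => // z _; rewrite yy0 smul0r.
have x10 (v : Z) : v \in Z1 -> v ** x = 0.
  by apply: even_act_right => // z z1; rewrite yE y10.
have [f fN eqZ1] := dim1_line dim1.
have f1 : f \in Z1 by rewrite eqZ1 memv_line.
have ff0 : f ** f \in Z0 := part_mul f1 f1.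
have [a [c ffE]] := indep2_span dim0 x0 y0 xy ff0.
(* (ff)x = f(fx + xf) = 0, while ff = ax + cy and yx = 0 make the left side ay. *)
have a0 : a = 0.
  have /eqP := zin0r f1 f1 x0.
  rewrite (x10 f) // (h01 x f) // addr0 smul0r ffE.
  rewrite smulDl !smulZl yE yx0 scaler0 addr0.
  rewrite scaler_eq0 => /orP[/eqP//|/eqP y_0]; case/negP: xxN.
  by rewrite y_0 mem0v.
rewrite a0 scale0r add0r in ffE.
have [c0|cN] := eqVneq c 0.
  exfalso; apply: Z_nonsplit; apply: split_parts.
  - by rewrite -dimv_eq0 dim0.
  - by rewrite -dimv_eq0 dim1.
  - move=> u v u0 v1; rewrite h01 //; split=> //.
    have [b [d ->]] := indep2_span dim0 x0 y0 xy u0.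
    by rewrite smulDr !smulZr x10 // y10 // !scaler0 addr0.
  - move=> u v; rewrite -/Z1 eqZ1 => /vlineP[b ->] /vlineP[d ->].
    by rewrite smulZl smulZr ffE c0 scale0r !scaler0.
have q0 : (sqrtC c)^-1 != 0 by rewrite invr_eq0 sqrtC_eq0.
exists (z3_9 K); split; first by constructor.
apply: (@super_iso_dim21 _ _ x y ((sqrtC c)^-1 *: f)) => //; rewrite ?memvZ //.
  by rewrite scaler_eq0 (negPf q0).
check_table; rewrite ?smulZl ?smulZr ?(x10 f) ?(y10 f) ?(h01 x f) ?(h01 y f)
  ?scaler0 //.
by rewrite ffE !scalerA -invfM -expr2 sqrtCK mulVf // scale1r.
Qed.

(** * Purely odd and purely even superalgebras *)

(** Products of odd vectors are even, hence zero here. Every subspace is then a graded ideal, and a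
    line with a complement splits [Z]. *)
Lemma dim_even_neq0 : \dim Z0 <> 0%N.
Proof.
move=> /eqP; rewrite dimv_eq0 => /eqP Z00; apply: Z_nonsplit.
have Z1full : Z1 = fullv by rewrite -part_sum -/Z0 Z00 add0v.
have prod (x y : Z) : x ** y = 0.
  have xyin : x ** y \in Z0.
    by apply: (@part_mul _ Z true true); rewrite -/Z1 Z1full memvf.
  by apply/eqP; rewrite -memv0 -Z00.
have ideal (U : {vspace Z}) : graded_ideal U.
  rewrite -[U]add0v; apply: graded_idealD; rewrite ?sub0v //.
    by rewrite -/Z1 Z1full subvf.
  by move=> x y _; rewrite !prod mem0v.
have xN : vpick {:Z} != 0 by rewrite vpick0 -dimv_eq0 Z_dim.
exists <[vpick {:Z}]>%VS, (<[vpick {:Z}]>^C)%VS.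
split; last by rewrite addv_complf capv_compl.
split=> //.
  by rewrite -dimv_eq0 dim_vline xN.
by rewrite -dimv_eq0 dimv_compl Z_dim dim_vline xN.
Qed.

(** With every vector even the sign never appears, and the identity map is the isomorphism. *)
Lemma even_super_iso : \dim Z1 = 0%N ->
  zinbiel (super_alg Z) /\ super_iso Z (even_superalgebra (super_alg Z)).
Proof.
move=> /eqP; rewrite dimv_eq0 => /eqP Z10.
have Z0full : Z0 = fullv by rewrite -part_sum -/Z1 Z10 addv0.
have in0 (x : Z) : x \in Z0 by rewrite Z0full memvf.
split; first by move=> x y z; apply: (zin0l (in0 x) (in0 y) (in0 z)).
exists \1%VF; split.
- by exists id => x; rewrite id_lfunE.
- by move=> x y; rewrite !id_lfunE.
- by move=> i; rewrite lim1g; case: i.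
Qed.

Lemma listed_mixed : \dim Z1 <> 0%N -> exists S, listed S /\ super_iso Z S.
Proof.
move=> dim1; have := dim_parts Z; rewrite Z_dim -/Z0 -/Z1.
have := dim_even_neq0; move: dim1; have := listed_dim12; have := listed_dim21.
case: (\dim Z0) (\dim Z1) => [|[|[|[|?]]]] [|[|[|[|?]]]] //= h21 h12 d1 d0 _ //.
  exact: h12.
exact: h21.
Qed.

End Classification.

(** * Existence and uniqueness over the complex numbers *)

Local Open Scope complex_scope.

Theorem theorem23 (R : realType) (Z : superalgebra R[i])
  (Z_zinbiel : zinbiel_super Z)
  (Z_dim : \dim {:Z} = 3%N)
  (Z_nonsplit : ~ split_super Z) :
  (exists A : algebra R[i],
     [/\ zinbiel A, \dim {:A} = 3%N & super_iso Z (even_superalgebra A)])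
  \/ (exists! S : superalgebra R[i], listed S /\ super_iso Z S).
Proof.
have [/eqP dim1|/eqP dim1] := boolP (\dim (part Z true) == 0%N).
  left; exists (super_alg Z).
  by have [] := even_super_iso Z_zinbiel dim1.
right; have [S [lS ZS]] := listed_mixed Z_zinbiel Z_dim Z_nonsplit dim1.
by exists S; split=> // S' [lS' ZS']; apply: (listed_iso_inj lS lS' ZS ZS').
Qed.
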